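(* For all $d\geq 2$, there exists a $d$-regular graph $G$ with $\chi_s(G)=\left\lceil\frac{d+4}{2}\right\rceil$.
   Context: A $k$-star colouring of a graph is a proper vertex colouring with $k$ colours in which no path on 4 vertices receives only two colours; $\chi_s(G)$ is the least $k$ for which $G$ admits a $k$-star colouring. *)

(* Defs.v *)
From mathcomp Require Import all_boot.

Set Implicit Arguments.
Unset Strict Implicit.
Unset Printing Implicit Defensive.

Record sgraph := SGraph {
  vertex :> finType;
  adj : rel vertex;
  adj_sym : symmetric adj;
  adj_irrefl : irreflexive adj
}.

Definition degree (G : sgraph) (x : G) : nat := #|[set y | adj x y]|.

Definition regular (G : sgraph) (d : nat) : Prop := forall x : G, degree x = d.

(* Not necessarily induced. *)
Definition is_path (G : sgraph) (p : seq G) : bool :=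
  uniq p && sorted (@adj G) p.

Definition proper_colouring (G : sgraph) (k : nat) (f : {ffun G -> 'I_k}) : bool :=
  [forall x, forall y, adj x y ==> (f x != f y)].

(* A proper colouring puts at least two colours on every path considered here. *)
Definition star_colouring (G : sgraph) (k : nat) (f : {ffun G -> 'I_k}) : bool :=
  proper_colouring f &&
  [forall p : 4.-tuple G, is_path p ==> (#|[set f x | x in p]| != 2)].

Definition star_colourable (G : sgraph) (k : nat) : bool :=
  [exists f : {ffun G -> 'I_k}, star_colouring f].

Lemma star_colourable_card (G : sgraph) : star_colourable G #|G|.
Proof.
apply/existsP; exists [ffun x => enum_rank x]; apply/andP; split.
  apply/forallP=> x; apply/forallP=> y; apply/implyP=> xy.
  rewrite !ffunE (inj_eq enum_rank_inj).
  by apply: contraTneq xy => ->; rewrite adj_irrefl.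
apply/forallP=> p; apply/implyP=> /andP[p_uniq _].
rewrite card_imset => [|x y]; last by rewrite !ffunE => /enum_rank_inj.
by move/card_uniqP: p_uniq => ->; rewrite size_tuple.
Qed.

Lemma ex_star_colourable (G : sgraph) : exists k, star_colourable G k.
Proof. by exists #|G|; apply: star_colourable_card. Qed.

Definition chi_s (G : sgraph) : nat := ex_minn (ex_star_colourable G).

(* Main.v *)
Require Import Defs.
From mathcomp Require Import all_boot zify.

Set Implicit Arguments.
Unset Strict Implicit.
Unset Printing Implicit Defensive.

(** Lower bound: call an edge xy lonely at x when no other neighbour of x has
    the colour of y. An edge lonely at neither end extends to a bicoloured path
    on 4 vertices, so in a star colouring some vertex x has at least d/2 lonely
    edges. Their other ends have distinct colours, which differ from that of x
    and from those of the remaining neighbours of x; hence d/2 <= k - 2, unless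
    all d edges are lonely at x, and then d <= k - 1.

    Construction: with k = m + 2, join the arcs (a, b) and (b, c), c <> a, of
    the complete digraph on k vertices, and colour (a, b) by b. Each arc has m
    successors, of distinct colours other than a, and m predecessors, all of
    colour a. Two neighbours of the same colour are therefore predecessors, and
    a bicoloured path on 4 vertices would orient its middle edge both ways. This
    gives d = 2m; for d = 2m - 1 a perfect matching is deleted from the bipartite
    double cover. *)

Section StarColouring.
Variables (G : sgraph) (k : nat) (f : {ffun G -> 'I_k}).

Definition bicoloured_path4_free : Prop :=
  forall w x y z : G, adj w x -> adj x y -> adj y z -> w != y -> x != z ->
    f w = f y -> f x = f z -> False.

Lemma star_colouringP :
  reflect ((forall x y : G, adj x y -> f x != f y) /\ bicoloured_path4_free)
          (star_colouring f).
Proof.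
apply: (iffP andP) => -[fP sP].
  have {}fP x y : adj x y -> f x != f y.
    by move: fP => /forallP/(_ x)/forallP/(_ y)/implyP.
  split=> // w x y z wx xy yz wy xz fwy fxz.
  have := forallP sP [tuple w; x; y; z]; rewrite /is_path /= wx xy yz !inE.
  have nf u v : f u != f v -> u == v = false by apply: contraNF => /eqP->.
  have fwx := fP _ _ wx.
  (* Properness also separates [w] from [z]: [f w] differs from [f x = f z]. *)
  rewrite (negPf wy) (negPf xz) (nf w x) // (nf w z) -?fxz // (nf x y) ?fP //.
  rewrite (nf y z) ?fP //=.
  suff -> : [set f u | u in [tuple w; x; y; z]] = [set f w; f x].
    by rewrite cards2 fwx.
  apply/setP => c; rewrite !inE; apply/imsetP/orP.
    case=> u; rewrite !inE => /or4P[] /eqP-> ->; rewrite ?fwy -?fxz eqxx; by [left | right].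
  by case=> /eqP->; [exists w | exists x]; rewrite // !inE eqxx ?orbT.
split; first by apply/forallP => x; apply/forallP => y; apply/implyP/fP.
apply/forallP => -[[|w [|x [|y [|z [|? ?]]]]] //= sz]; set p := (X in is_path X).
apply/implyP; rewrite /is_path /= !inE !negb_or -!andbA andbT.
case/and5P => wx wy wz xy /and5P[xz yz _ awx /andP[axy ayz]].
have in_im u : u \in [:: w; x; y; z] -> f u \in [set f u | u in p].
  by move=> up; apply: imset_f.
(* With two colours in all, vertices two steps apart on the path agree, as both differ from the one
   between. *)
have three a b c : a \in [:: w; x; y; z] -> b \in [:: w; x; y; z] ->
    c \in [:: w; x; y; z] -> #|[set f u | u in p]| = 2 ->
    f a != f b -> f b != f c -> f a = f c.
  move=> ap bp cp im2 ab bc; apply/eqP/negPn/negP => ac.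
  suff: 3 <= 2 by [].
  rewrite -{2}im2.
  have <- : #|[set f a; f b; f c]| = 3.
    by rewrite -setUA cardsU1 cards2 !inE negb_or ab ac bc.
  by apply/subset_leq_card/subsetP => u; rewrite !inE => /orP[/orP[]|] /eqP->; apply: in_im.
apply/eqP => im2; apply: (sP w x y z) => //.
  by apply: (three w x y); rewrite ?inE ?eqxx ?orbT ?fP.
by apply: (three x y z); rewrite ?inE ?eqxx ?orbT ?fP.
Qed.

Definition lonely (x y : G) : bool :=
  adj x y && [forall z, adj x z ==> (f z == f y) ==> (z == y)].

Lemma lonelyP x y z : lonely x y -> adj x z -> f z = f y -> z = y.
Proof. by case/andP => _ /forallP/(_ z)/implyP H /H/implyP + /eqP => /[apply]/eqP. Qed.

Lemma not_lonely x y : adj x y -> ~~ lonely x y ->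
  exists2 z, adj x z & f z = f y /\ z != y.
Proof.
move=> xy; rewrite /lonely xy /= negb_forall => /existsP[z].
by rewrite !negb_imply => /and3P[xz /eqP fz zy]; exists z.
Qed.

Hypothesis f_star : star_colouring f.

Lemma lonely_total x y : adj x y -> lonely x y || lonely y x.
Proof.
have [fP sP] := star_colouringP f_star.
move=> xy; apply/norP => -[/(not_lonely xy)[w xw [fw wy]]].
rewrite adj_sym in xy => /(not_lonely xy)[z yz [fz zx]].
by apply: (sP w x y z); rewrite // 1?adj_sym // eq_sym.
Qed.

Lemma regular_star_colouring_bound d (x0 : G) :
  1 < d -> regular G d -> d + 4 <= k.*2.
Proof.
move=> d_gt1 G_reg; have [fP _] := star_colouringP f_star.
have [x dx] : exists x, d <= #|lonely x|.*2.
  apply/existsP; apply: contraT; rewrite negb_exists => /forallP few.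
  (* Each ordered adjacent pair adds 1 on the left and, once the second sum is transposed, at least
     1 on the right by [lonely_total]. *)
  have : \sum_(x : G) d <= \sum_x #|lonely x| + \sum_x #|lonely x|.
    have card_sum (P : pred G) : #|P| = \sum_y P y.
      by rewrite -sum1_card big_mkcond; apply: eq_bigr => y _; rewrite unfold_in; case: (P y).
    have -> : \sum_(x : G) d = \sum_(x : G) \sum_(y : G) adj x y.
      by apply: eq_bigr => x _; rewrite -(G_reg x) /degree cardsE card_sum.
    have e : \sum_x #|lonely x| = \sum_x \sum_y lonely x y.
      by apply: eq_bigr => x _; apply: card_sum.
    rewrite {2}e [X in _ + X]exchange_big e -big_split /=; apply: leq_sum => x _.
    rewrite -big_split /=; apply: leq_sum => y _.
    by case: (boolP (adj x y)) => [xy|//]; have := lonely_total xy; do 2!case: lonely.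
  rewrite -big_split leqNgt => /negP[] /=.
  (* The term at [x0] keeps the inequality strict after summation. *)
  rewrite (bigD1 x0) //= [ltnRHS](bigD1 x0) //= -addSn leq_add //.
    by have := few x0; rewrite -ltnNge addnn.
  by apply: leq_sum => x _; have := few x; rewrite addnn -ltnNge => /ltnW.
have f_inj : {in lonely x &, injective f}.
  by move=> y z /andP[xy _] lz fyz; apply: lonelyP lz xy fyz.
have card_im : #|[set f y | y in lonely x]| = #|lonely x| by apply: card_in_imset.
have xN : f x \notin [set f y | y in lonely x].
  by apply/imsetP => -[y /andP[/fP + _] e]; rewrite e eqxx.
case: (boolP [forall y, adj x y ==> lonely x y]) => [/forallP all_lonely|].
  have eqd : #|lonely x| = d.
    rewrite -(G_reg x) /degree cardsE; apply: eq_card => y.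
    rewrite !unfold_in; apply/idP/idP => [/andP[]//|]; exact: implyP.
  (* This gives [d + 1 <= k], and [d + 4 <= 2 * (d + 1)] because [1 < d]. *)
  have := max_card [in f x |: [set f y | y in lonely x]].
  rewrite cardsU1 xN card_im card_ord eqd; lia.
rewrite negb_forall => /existsP[z]; rewrite negb_imply => /andP[xz lz].
have zN : f z \notin [set f y | y in lonely x].
  apply/imsetP => -[y ly e]; have zy := lonelyP ly xz e.
  by move: lz; rewrite zy => /negP; apply.
have := max_card [in f x |: (f z |: [set f y | y in lonely x])].
rewrite !cardsU1 !inE negb_or fP // xN zN card_im card_ord; lia.
Qed.

End StarColouring.

Section ArcGraph.
Variables (n : nat) (del : bool).

(* ((b, x), e) stands for the arc from [lift b x] to b on the sheet e of the
   double cover. *)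
Definition arc : Type := 'I_n.+1 * 'I_n * bool.

(* If [del], the arcs (a, b) of one sheet lose one successor (b, c), where
   [a |-> c] permutes the vertices other than b cyclically. *)
Definition arc_succ (u v : arc) : bool :=
  let: (b, x, e) := u in let: (c, y, e') := v in
  [&& e' == ~~ e, lift c y == b, c != lift b x
    & ~~ [&& del, e & c == lift b (ordS x)]].

Definition arc_adj (u v : arc) : bool := arc_succ u v || arc_succ v u.

Lemma arc_succ_asym u v : arc_succ u v -> ~~ arc_succ v u.
Proof.
case: u v => [[b x] e] [[c y] e'] /and4P[_ _ cb _].
by apply/and4P => -[_ /eqP bc _ _]; rewrite bc eqxx in cb.
Qed.

Lemma arc_adj_sym : symmetric arc_adj.
Proof. by move=> u v; rewrite /arc_adj orbC. Qed.

Lemma arc_adj_irrefl : irreflexive arc_adj.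
Proof.
by move=> u; rewrite /arc_adj orbb; apply/negbTE/negP => uu; have := arc_succ_asym uu; rewrite uu.
Qed.

Definition arc_graph : sgraph := SGraph arc_adj_sym arc_adj_irrefl.

Lemma lift_ex (b c : 'I_n.+1) : b != c -> exists z, c = lift b z.
Proof. by case/unlift_some => z -> _; exists z. Qed.

Hypothesis n_gt1 : 1 < n.

Lemma ordS_neq (x : 'I_n) : ordS x != x.
Proof.
rewrite -val_eqE /=; have := ltn_ord x.
by rewrite leq_eqVlt => /orP[/eqP e|lt]; [rewrite {1}e modnn; lia | rewrite modn_small; lia].
Qed.

Lemma card_arc_succ (u : arc) : #|[set v | arc_succ u v]| = n.-1 - (del && u.2).
Proof.
case: u => [[b x] e] /=.
(* A successor is determined by its head; [S] collects the forbidden heads, which are distinct by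
   [ordS_neq]. *)
set S := [set b; lift b x] :|: (if del && e then [set lift b (ordS x)] else set0).
have cardS : #|~: S| = n.-1 - (del && e).
  rewrite cardsCs setCK card_ord /S; case: (del && e); last first.
    by rewrite setU0 cards2 neq_lift; lia.
  rewrite setUC cardsU1 cards2 !inE neq_lift (eq_sym _ b) (negPf (neq_lift _ _)) /=.
  by rewrite (inj_eq lift_inj) (negPf (ordS_neq x)); lia.
rewrite -cardS -(@card_in_imset _ _ (fun v : arc => v.1.1)); last first.
  move=> [[c y] e'] [[c' y'] e'']; rewrite !inE /=.
  move=> /and4P[/eqP-> /eqP cy _ _] /and4P[/eqP-> /eqP cy' _ _] e1.
  by move: cy'; rewrite -e1 -cy => /lift_inj->.
apply: eq_card => c; rewrite /S !inE; apply/imsetP/idP.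
  case=> -[[c' y] e']; rewrite inE => /and4P[_ /eqP<- cb H] /= ->.
  move: cb H; rewrite (negPf (neq_lift _ _)) => /negPf->; rewrite /= andbA.
  by case: (del && e); rewrite inE.
rewrite !negb_or -andbA => /and3P[cb cx H].
have [y by_] := lift_ex cb; exists (c, y, ~~ e); rewrite // inE /= eqxx -by_ eqxx cx /= andbA.
by case: (del && e) H; rewrite inE.
Qed.

Lemma card_arc_pred (v : arc) : #|[set u | arc_succ u v]| = n.-1 - (del && ~~ v.2).
Proof.
case: v => [[c y] e] /=; set b := lift c y.
have bc : b != c by rewrite eq_sym neq_lift.
have [z cz] := lift_ex bc.
(* A predecessor has head [b], so only the coordinate of its tail is free; [S] collects the
   forbidden values, and [ord_pred z] is the one that [ordS] sends to [z]. *)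
set S := z |: (if del && ~~ e then [set ord_pred z] else set0).
have cardS : #|~: S| = n.-1 - (del && ~~ e).
  rewrite cardsCs setCK card_ord /S; case: (del && ~~ e); last by rewrite setU0 cards1; lia.
  by rewrite cards2 -{1}(ord_predK z) ordS_neq; lia.
have h_inj : injective (fun x : 'I_n => (b, x, ~~ e)) by move=> x x' [].
rewrite -cardS -(card_imset _ h_inj); apply: eq_card => -[[b' x] e'].
rewrite inE; apply/idP/imsetP.
  case/and4P => /eqP ee' /eqP b'b xc H; have e'e : e' = ~~ e by rewrite ee' negbK.
  rewrite -b'b e'e; exists x => //; rewrite /S !inE; move: xc H.
  rewrite e'e -b'b -/b {1 2}cz !(inj_eq lift_inj) eq_sym => /negPf-> /=.
  rewrite andbA; case: (del && ~~ e) => /=; rewrite inE //.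
  by apply: contraNN => /eqP->; rewrite ord_predK.
case=> x' H [-> -> ->]; move: H; rewrite /= negbK !eqxx /= [lift b _]lock.
rewrite {1 2}cz -!lock !(inj_eq lift_inj) /S !inE negb_or andbA eq_sym => /andP[-> /=].
case: (del && ~~ e) => //=; rewrite inE.
by apply: contraNN => /eqP->; rewrite ordSK.
Qed.

(** Under deletion, a vertex on sheet [true] loses one successor and a vertex on the other sheet one
    predecessor. *)
Lemma arc_graph_regular : regular arc_graph (n.-1.*2 - del).
Proof.
move=> u; rewrite /degree.
have -> : [set v | adj u v] = [set v | arc_succ u v] :|: [set v | arc_succ v u].
  by apply/setP => v; rewrite !inE.
rewrite cardsU disjoint_setI0 ?cards0 ?card_arc_succ ?card_arc_pred; last first.
  rewrite disjoints_subset; apply/subsetP => v; rewrite !inE; exact: arc_succ_asym.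
by case: del u.2 => -[] /=; lia.
Qed.

Definition arc_colour : {ffun arc_graph -> 'I_n.+1} := [ffun v : arc => v.1.1].

(** If [u] were a successor of [v], then [w] would be a successor with the same head, hence equal to
    [u], or a predecessor, coloured by the tail of [v], which the head of [u] avoids. *)
Lemma arc_colour_pred (u v w : arc) :
  arc_adj v u -> arc_adj v w -> u != w -> u.1.1 = w.1.1 -> arc_succ u v.
Proof.
case: u v w => [[b x] e] [[b' x'] e'] [[b'' x''] e''] /orP[|//] uv.
move=> vw + /= bb; rewrite -{}bb in vw *; move: uv => /and4P[/eqP-> /eqP bx bN _].
case/orP: vw => /and4P[].
  by move=> /eqP-> /eqP; rewrite -bx => /lift_inj-> _ _; rewrite eqxx.
by move=> _ /eqP e1; rewrite e1 eqxx in bN.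
Qed.

Lemma arc_star_colouring : star_colouring arc_colour.
Proof.
apply/star_colouringP; split.
  suff H (u v : arc) : arc_succ u v -> u.1.1 != v.1.1.
    by move=> u v; rewrite !ffunE => /orP[]/H; rewrite // eq_sym.
  by case: u v => [[b x] e] [[c y] e'] /and4P[_ /eqP<- _ _]; rewrite eq_sym neq_lift.
move=> w x y z wx xy yz wy xz; rewrite !ffunE => fwy fxz.
have xy_succ : arc_succ x y.
  by apply: (@arc_colour_pred x y z) => //; rewrite arc_adj_sym.
have /negP[] := arc_succ_asym xy_succ.
by apply: (@arc_colour_pred y x w); rewrite // 1?eq_sym // arc_adj_sym.
Qed.

End ArcGraph.

Theorem theorem5 (d : nat) (hd : 2 <= d) :
  exists G : sgraph, regular G d /\ chi_s G = uphalf (d + 4).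
Proof.
have [n [n_gt1 nd nk]] : exists n, [/\ 1 < n, n.-1.*2 - odd d = d & n.+1 = uphalf (d + 4)].
  (* Here [m = uphalf d] and [n = m + 1]; the matching is deleted exactly when [d] is odd. *)
  by exists (uphalf d).+1; split; lia.
have reg := @arc_graph_regular n (odd d) n_gt1; rewrite nd in reg.
exists (arc_graph n (odd d)); split=> //; rewrite /chi_s.
case: ex_minnP => k /existsP[f f_star] k_min; apply/eqP; rewrite eqn_leq; apply/andP; split.
  by rewrite -nk; apply: k_min; apply/existsP; exists (arc_colour n (odd d)); apply: arc_star_colouring.
pose x0 : arc_graph n (odd d) := (ord0, Ordinal n_gt1, true).
by have := regular_star_colouring_bound f_star x0 hd reg; lia.
Qed.
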